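(* Consider the centralised market clearing problem (C) and its Lagrangian relaxation with respect to the balance constraints, as given in the context. Consider the iterative process, started from arbitrary initial multipliers, where at each iteration $k\ge1$ the vector $x^{(k)}$ (with components $x_o^{g\,(k)},x_o^{e\,(k)},x_o^{h\,(k)},x_{co}^{g\to e\,(k)},x_{co}^{g\to h\,(k)}$) is obtained by solving the gas, electricity, heat and conversion subproblems with multipliers $\pi^{g\,(k)},\pi^{e\,(k)},\pi^{h\,(k)}$, and the multipliers are updated by $$\pi^{g\,(k+1)}=\pi^{g\,(k)}+\mu_k\Big(\sum_{o\in\mathcal O^g}Q_o^gx_o^{g\,(k)}+\sum_{co\in\mathcal O^{g\to e}}Q_{co}^{g\to e}x_{co}^{g\to e\,(k)}+\sum_{co\in\mathcal O^{g\to h}}Q_{co}^{g\to h}x_{co}^{g\to h\,(k)}\Big),$$ $$\pi^{e\,(k+1)}=\pi^{e\,(k)}+\mu_k\Big(\sum_{o\in\mathcal O^e}Q_o^ex_o^{e\,(k)}-\sum_{co\in\mathcal O^{g\to e}}\eta_{co}^{g\to e}Q_{co}^{g\to e}x_{co}^{g\to e\,(k)}\Big),$$ $$\pi^{h\,(k+1)}=\pi^{h\,(k)}+\mu_k\Big(\sum_{o\in\mathcal O^h}Q_o^hx_o^{h\,(k)}-\sum_{co\in\mathcal O^{g\to h}}\eta_{co}^{g\to h}Q_{co}^{g\to h}x_{co}^{g\to h\,(k)}\Big),$$ with step-length $\mu_k=\frac1k$. Then any accumulation point of the sequence of averaged iterates $\overline x^{(k)}=\frac1k\sum_{i=1}^kx^{(i)}$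 is an optimal solution of (C).
   Context: Carriers are gas ($g$), electricity ($e$), heat ($h$). $\mathcal O^c$ is a finite set of elementary orders of carrier $c$, with limit price $P_o^c$, quantity $Q_o^c$ ($<0$ for sell, $>0$ for buy) and acceptance ratio $x_o^c$. $\mathcal O^{g\to e},\mathcal O^{g\to h}$ are finite sets of conversion orders with conversion price $P_{co}$, capacity $Q_{co}>0$, efficiency $\eta_{co}>0$ and acceptance ratio $x_{co}$ (with the corresponding superscript). Problem (C): maximise $$\Theta(x)=\sum_{c\in\{g,e,h\}}\sum_{o\in\mathcal O^c}P_o^cQ_o^cx_o^c-\sum_{co\in\mathcal O^{g\to e}}P_{co}^{g\to e}Q_{co}^{g\to e}x_{co}^{g\to e}-\sum_{co\in\mathcal O^{g\to h}}P_{co}^{g\to h}Q_{co}^{g\to h}x_{co}^{g\to h}$$ subject to the balance constraints $\beta^g(x)=\beta^e(x)=\beta^h(x)=0$ and all variables in $[0,1]$, where $\beta^g(x)=\sum_{o\in\mathcal O^g}Q_o^gx_o^g+\sum_{co\in\mathcal O^{g\to e}}Q_{co}^{g\to e}x_{co}^{g\to e}+\sum_{co\in\mathcal O^{g\to h}}Q_{co}^{g\to h}x_{co}^{g\to h}$, $\beta^e(x)=\sum_{o\in\mathcal O^e}Q_o^ex_o^e-\sum_{co\in\mathcal O^{g\to e}}\eta_{co}^{g\to e}Q_{co}^{g\to e}x_{co}^{g\to e}$, $\beta^h(x)=\sum_{o\in\mathcal O^h}Q_o^hx_o^h-\sum_{co\in\mathcal O^{g\to h}}\eta_{co}^{g\to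 h}Q_{co}^{g\to h}x_{co}^{g\to h}$. Lagrangian relaxation: $\phi(\pi^g,\pi^e,\pi^h)=\max_{0\le x\le1}\{\Theta(x)-\pi^g\beta^g(x)-\pi^e\beta^e(x)-\pi^h\beta^h(x)\}$. For fixed multipliers it splits into the subproblems (all variables in $[0,1]$): Carrier $c\in\{g,e,h\}$: maximise $\sum_{o\in\mathcal O^c}P_o^cQ_o^cx_o^c-\pi^c\sum_{o\in\mathcal O^c}Q_o^cx_o^c$. Conversion: maximise $\sum_{co\in\mathcal O^{g\to e}}(\eta_{co}^{g\to e}\pi^e-\pi^g-P_{co}^{g\to e})Q_{co}^{g\to e}x_{co}^{g\to e}+\sum_{co\in\mathcal O^{g\to h}}(\eta_{co}^{g\to h}\pi^h-\pi^g-P_{co}^{g\to h})Q_{co}^{g\to h}x_{co}^{g\to h}$. At each iteration any optimal solution of each subproblem may be chosen. *)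

(* Defs.v *)
From HB Require Import structures.
From mathcomp Require Import all_boot all_order all_algebra.
From mathcomp Require Import all_classical all_reals all_analysis.
From mathcomp Require Import ring.

Set Implicit Arguments.
Unset Strict Implicit.
Unset Printing Implicit Defensive.
Import Order.TTheory GRing.Theory Num.Theory.
Import numFieldNormedType.Exports.
Local Open Scope classical_set_scope.
Local Open Scope ring_scope.

Inductive carrier := gas | elec | heat.

Inductive conversion := gas_to_elec | gas_to_heat.

(* Quantities of elementary orders are signed: negative for sell orders,
   positive for buy orders. *)
Record market (R : realType) := Market {
  order : carrier -> finType;
  price : forall c, order c -> R;
  qty : forall c, order c -> R;
  conv_order : conversion -> finType;
  conv_price : forall t, conv_order t -> R;
  conv_qty : forall t, conv_order t -> R;
  efficiency : forall t, conv_order t -> R;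
  qty_neq0 : forall c (o : order c), qty o != 0;
  conv_qty_gt0 : forall t (co : conv_order t), 0 < conv_qty co;
  efficiency_gt0 : forall t (co : conv_order t), 0 < efficiency co
}.

Arguments price {R} m {c} o.
Arguments qty {R} m {c} o.
Arguments conv_price {R} m {t} co.
Arguments conv_qty {R} m {t} co.
Arguments efficiency {R} m {t} co.

Inductive var (R : realType) (M : market R) :=
  | Elem c of order M c
  | Conv t of conv_order M t.

Arguments Elem {R M c} _.
Arguments Conv {R M t} _.

(* Vectors of acceptance ratios. There are finitely many variables, so the
   pointwise topology is the Euclidean one. *)
Definition acceptance (R : realType) (M : market R) := {ptws var M -> R}.

Definition maximizer (R : realType) (T : Type) (S : set T) (f : T -> R) (x : T) :=
  S x /\ forall y, S y -> f y <= f x.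

Section Market.
Variables (R : realType) (M : market R).
Implicit Types (x : acceptance M) (lam : carrier -> R).

Definition welfare x : R :=
  \sum_(o : order M gas) price M o * qty M o * x (Elem o)
  + \sum_(o : order M elec) price M o * qty M o * x (Elem o)
  + \sum_(o : order M heat) price M o * qty M o * x (Elem o)
  - \sum_(co : conv_order M gas_to_elec)
      conv_price M co * conv_qty M co * x (Conv co)
  - \sum_(co : conv_order M gas_to_heat)
      conv_price M co * conv_qty M co * x (Conv co).

Definition balance x (c : carrier) : R :=
  \sum_(o : order M c) qty M o * x (Elem o) +
  match c with
  | gas => \sum_(co : conv_order M gas_to_elec) conv_qty M co * x (Conv co)
           + \sum_(co : conv_order M gas_to_heat) conv_qty M co * x (Conv co)
  | elec => - \sum_(co : conv_order M gas_to_elec)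
                efficiency M co * conv_qty M co * x (Conv co)
  | heat => - \sum_(co : conv_order M gas_to_heat)
                efficiency M co * conv_qty M co * x (Conv co)
  end.

Definition feasible : set (acceptance M) :=
  [set x | (forall c, balance x c = 0) /\ (forall v, 0 <= x v <= 1)].

Definition optimal_clearing : set (acceptance M) :=
  [set x | maximizer feasible welfare x].

Definition carrier_objective lam c (y : order M c -> R) : R :=
  \sum_(o : order M c) price M o * qty M o * y o
  - lam c * \sum_(o : order M c) qty M o * y o.

Definition carrier_box c : set (order M c -> R) :=
  [set y | forall o, 0 <= y o <= 1].

Definition conv_objective lam (z : forall t, conv_order M t -> R) : R :=
  \sum_(co : conv_order M gas_to_elec)
    (efficiency M co * lam elec - lam gas - conv_price M co)
    * conv_qty M co * z _ co
  + \sum_(co : conv_order M gas_to_heat)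
    (efficiency M co * lam heat - lam gas - conv_price M co)
    * conv_qty M co * z _ co.

Definition conv_box : set (forall t, conv_order M t -> R) :=
  [set z | forall t co, 0 <= z t co <= 1].

Definition solves_carrier lam c x : Prop :=
  maximizer (@carrier_box c) (carrier_objective lam (c := c))
    (fun o => x (Elem o)).

Definition solves_conversion lam x : Prop :=
  maximizer conv_box (conv_objective lam) (fun t co => x (Conv co)).

Definition lagrangian lam x : R :=
  welfare x - lam gas * balance x gas - lam elec * balance x elec
  - lam heat * balance x heat.

Lemma lagrangian_split lam x :
  lagrangian lam x =
    carrier_objective lam (fun o : order M gas => x (Elem o))
    + carrier_objective lam (fun o : order M elec => x (Elem o))
    + carrier_objective lam (fun o : order M heat => x (Elem o))
    + conv_objective lam (fun t co => x (Conv co)).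
Proof.
have convE t a : \sum_(co : conv_order M t)
    (efficiency M co * a - lam gas - conv_price M co)
      * conv_qty M co * x (Conv co) =
  a * (\sum_(co : conv_order M t) efficiency M co * conv_qty M co * x (Conv co))
  - lam gas * (\sum_(co : conv_order M t) conv_qty M co * x (Conv co))
  - \sum_(co : conv_order M t) conv_price M co * conv_qty M co * x (Conv co).
  rewrite !mulr_sumr -!sumrB; apply: eq_bigr => co _; ring.
rewrite /lagrangian /welfare /balance /carrier_objective /conv_objective !convE.
ring.
Qed.

(* Meaningful for k >= 1. *)
Definition average (x : nat -> acceptance M) (k : nat) : acceptance M :=
  fun v => k%:R^-1 * \sum_(1 <= i < k.+1) x i v.

(* The terms of index 0 of the two sequences are unconstrained and unused. *)
Definition subgradient_process
    (lam : nat -> carrier -> R) (x : nat -> acceptance M) : Prop :=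
  forall k, (1 <= k)%N ->
    [/\ forall c, solves_carrier (lam k) c (x k),
        solves_conversion (lam k) (x k) &
        forall c, lam k.+1 c = lam k c + k%:R^-1 * balance (x k) c].

End Market.

(* Main.v *)
(** Write [beta] for the vector of balances. The update reads
    [beta (x k) = k (lam (k+1) - lam k)], so summation by parts turns the average
    of the first [K] balances into [lam (K+1)] minus the average of
    [lam 1, ..., lam K]. This tends to 0 by Cesaro as soon as [lam] converges.
    Moreover [x k] maximises the Lagrangian at [lam k], so for feasible [y] the
    average welfare of the iterates is at least the welfare of [y] plus the average
    of [lam k . beta (x k)], which vanishes in the limit for the same reason.
    Convergence of [lam] is the quasi-Fejer property of the subgradient method: the
    steps are square summable but not summable, hence the distance to every dual
    optimum converges, and some cluster point is itself a dual optimum. The dual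
    function is a finite maximum of affine functions that is bounded below;
    Fourier-Motzkin elimination shows that its minimum is attained. *)

Require Import Defs.
From mathcomp Require Import all_boot all_order all_algebra.
From mathcomp Require Import all_classical all_reals all_analysis.
From mathcomp Require Import ring lra.
Set Implicit Arguments.
Unset Strict Implicit.
Unset Printing Implicit Defensive.
Import Order.TTheory GRing.Theory Num.Theory.
Import numFieldNormedType.Exports.
Local Open Scope classical_set_scope.
Local Open Scope ring_scope.

(** * Linear inequalities and Fourier-Motzkin elimination *)

(* A triple [(a, b, e)] encodes the constraint [a . l <= b + e * s]. *)
Definition satisfies {R : realFieldType} {C : eqType} (js : seq C) (l : C -> R)
    (s : R) (r : (C -> R) * R * R) : bool :=
  \sum_(j <- js) r.1.1 j * l j <= r.1.2 + r.2 * s.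

(** The weights cancel the coefficient of [j]. Both are positive when [r1] has a negative and [r2] a
    positive coefficient there, so the result then follows from the two constraints. *)
Definition combine {R : realFieldType} {C : eqType} (j : C)
    (r1 r2 : (C -> R) * R * R) : (C -> R) * R * R :=
  (fun i => r2.1.1 j * r1.1.1 i - r1.1.1 j * r2.1.1 i,
   r2.1.1 j * r1.1.2 - r1.1.1 j * r2.1.2,
   r2.1.1 j * r1.2 - r1.1.1 j * r2.2).

Definition eliminate {R : realFieldType} {C : eqType} (j : C)
    (rs : seq ((C -> R) * R * R)) : seq ((C -> R) * R * R) :=
  [seq r <- rs | r.1.1 j == 0] ++
  [seq combine j r1 r2 | r1 <- [seq r <- rs | r.1.1 j < 0],
                         r2 <- [seq r <- rs | 0 < r.1.1 j]].

Lemma exists_between (R : realFieldType) (lo hi : seq R) :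
  (forall x y, x \in lo -> y \in hi -> x <= y) ->
  exists t, (forall x, x \in lo -> x <= t) /\ (forall y, y \in hi -> t <= y).
Proof.
move=> lohi.
have [->|[x0 x0lo]] : lo = [::] \/ exists x, x \in lo.
- by case: lo {lohi} => [|x ?]; [left|right; exists x; rewrite mem_head].
- suff [t tP] : exists t, forall y, y \in hi -> t <= y by exists t; split.
  elim: hi {lohi} => [|y hi [t tP]]; first by exists 0.
  exists (Num.min y t) => z; rewrite inE => /predU1P[->|/tP tz].
    by rewrite ge_min lexx.
  by rewrite ge_min tz orbT.
- suff [t [tlo tP]] : exists t, t \in lo /\ forall x, x \in lo -> x <= t.
    by exists t; split=> // y; exact: lohi.
  elim: lo x0 x0lo {lohi} => // x lo IH x0 _.
  have [->|[x1 x1lo]] : lo = [::] \/ exists x, x \in lo.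
  + by case: (lo) => [|x1 ?]; [left|right; exists x1; rewrite mem_head].
  + by exists x; rewrite mem_head; split=> // z; rewrite inE => /eqP ->.
  + have [t [tlo tP]] := IH _ x1lo.
    exists (Num.max x t); split.
      by rewrite inE; case: leP => _; rewrite ?eqxx// tlo orbT.
    move=> z; rewrite inE => /predU1P[->|/tP zt]; rewrite le_max ?lexx//.
    by rewrite zt orbT.
Qed.

Lemma satisfies_combine (R : realFieldType) (C : eqType) (js : seq C) (j : C)
    (l : C -> R) (s : R) (r1 r2 : (C -> R) * R * R) :
  satisfies js l s (combine j r1 r2) =
  (r2.1.1 j * (\sum_(i <- js) r1.1.1 i * l i - (r1.1.2 + r1.2 * s)) <=
   r1.1.1 j * (\sum_(i <- js) r2.1.1 i * l i - (r2.1.2 + r2.2 * s))).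
Proof.
rewrite /satisfies /=.
rewrite (eq_bigr (fun i => r2.1.1 j * (r1.1.1 i * l i)
   - r1.1.1 j * (r2.1.1 i * l i))); last by move=> i _; ring.
rewrite sumrB -!mulr_sumr -subr_ge0 -[RHS]subr_ge0; congr (0 <= _); ring.
Qed.

(** Constraints with a negative coefficient at [j] bound [l j] from below, those with a positive one
    from above. The combined constraints say that each lower bound is at most each upper bound, and
    [exists_between] then supplies a value for [l j]. *)
Lemma eliminateP (R : realFieldType) (C : eqType) (j : C) (js : seq C)
    (rs : seq ((C -> R) * R * R)) (s : R) : j \notin js ->
  (exists l, all (satisfies (j :: js) l s) rs) <->
  (exists l, all (satisfies js l s) (eliminate j rs)).
Proof.
move=> jjs.
pose gap l (r : (C -> R) * R * R) :=
  \sum_(i <- js) r.1.1 i * l i - (r.1.2 + r.2 * s).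
have gapE l r : satisfies (j :: js) l s r = (r.1.1 j * l j + gap l r <= 0).
  by rewrite /satisfies big_cons -subr_le0 addrA.
split=> -[l /allP lP].
  exists l; rewrite all_cat; apply/andP; split; apply/allP => r.
    rewrite mem_filter => /andP[/eqP rj0 /lP].
    by rewrite /satisfies big_cons rj0 mul0r add0r.
  case/allpairsP => -[r1 r2] /= []; rewrite !mem_filter.
  move=> /andP[r1j /lP + ] /andP[r2j /lP +] ->.
  rewrite !gapE satisfies_combine -!/(gap _ _) => h1 h2.
  nra.
move: lP => /[dup] lP.
have := @exists_between _ [seq - (gap l r / r.1.1 j) | r <- rs & r.1.1 j < 0]
  [seq - (gap l r / r.1.1 j) | r <- rs & 0 < r.1.1 j].
case.
  move=> _ _ /mapP[r1 + ->] /mapP[r2 + ->].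
  move=> r1s r2s; have := lP (combine j r1 r2).
  rewrite mem_cat allpairs_f// orbT satisfies_combine => /(_ isT).
  move: r1s r2s; rewrite !mem_filter => /andP[r1j _] /andP[r2j _].
  rewrite -!/(gap _ _) lerN2 ler_ndivlMr// mulrAC ler_pdivlMr//.
  by rewrite mulrC [X in _ <= X]mulrC.
move=> t [tlo thi] _; exists (fun i => if i == j then t else l i).
apply/allP => r rrs; rewrite gapE eqxx.
have -> : gap (fun i => if i == j then t else l i) r = gap l r.
  congr (_ - _); apply: eq_big_seq => i ijs; case: eqP => // ij.
  by rewrite -ij ijs in jjs.
have [rj|rj|rj] := ltgtP (r.1.1 j) 0.
- have : - (gap l r / r.1.1 j) <= t.
    apply/tlo/(map_f (fun r => - (gap l r / r.1.1 j))).
    by rewrite mem_filter rj.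
  by rewrite lerNl ler_ndivlMr// mulNr mulrC; lra.
- have : t <= - (gap l r / r.1.1 j).
    apply/thi/(map_f (fun r => - (gap l r / r.1.1 j))).
    by rewrite mem_filter rj.
  by rewrite lerNr ler_pdivrMr// mulNr mulrC; lra.
- have /lP : r \in eliminate j rs.
    by rewrite mem_cat mem_filter rj eqxx rrs.
  by rewrite /satisfies -subr_le0 rj mul0r add0r.
Qed.

Lemma fourier_motzkin (R : realFieldType) (C : eqType) (js : seq C)
    (rs : seq ((C -> R) * R * R)) : uniq js ->
  exists ts : seq (R * R), forall s,
    (exists l, all (satisfies js l s) rs) <->
    all (fun t => 0 <= t.1 + t.2 * s) ts.
Proof.
elim: js rs => [|j js IH] rs /=.
  exists [seq (r.1.2, r.2) | r <- rs] => s; rewrite all_map /satisfies.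
  split=> [[l]|rP]; last exists (fun=> 0); [move=> rP|];
    by apply: sub_all rP => r /=; rewrite big_nil.
move=> /andP[jjs /(IH (eliminate j rs))[ts tsP]]; exists ts => s.
by rewrite eliminateP.
Qed.

(** By [fourier_motzkin] the attainable [s] are cut out by finitely many weak affine inequalities.
    They form a closed set, which therefore contains its infimum. *)
Lemma fourier_motzkin_min (R : realType) (C : eqType) (js : seq C)
    (rs : seq ((C -> R) * R * R)) (m : R) : uniq js ->
  (exists s l, all (satisfies js l s) rs) ->
  (forall s l, all (satisfies js l s) rs -> m <= s) ->
  exists s, (exists l, all (satisfies js l s) rs) /\
    forall s' l, all (satisfies js l s') rs -> s <= s'.
Proof.
move=> /fourier_motzkin-/(_ _ rs)[ts tsP] [s0 s0P] lb.
pose S := [set s | exists l, all (satisfies js l s) rs].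
have lbS : lbound S m by move=> s [l] /lb.
have infS : has_inf S by split; [exists s0|exists m].
exists (inf S); split; last first.
  by move=> s l lP; apply: ge_inf; [exists m|exists l].
apply/tsP/allP => -[b e] ts_be /=.
apply/ler_addgt0Pl => eps eps0.
(* The [+ 1] keeps the denominator positive when [e = 0]. *)
have d0 : 0 < eps / (`|e| + 1) by rewrite divr_gt0// ltr_wpDl.
have [s Ss sinf] := inf_adherent d0 infS.
have infs : inf S <= s by apply: ge_inf => //; exists m.
have /allP/(_ _ ts_be)/= bes := (tsP s).1 Ss.
have es : e * (s - inf S) <= eps.
  apply: (@le_trans _ _ (`|e| * (s - inf S))).
    by rewrite ler_wpM2r ?subr_ge0// ler_norm.
  apply: (@le_trans _ _ ((`|e| + 1) * (eps / (`|e| + 1)))).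
    by apply: ler_pM; rewrite ?subr_ge0//; lra.
  by rewrite mulrC divfK// gt_eqF// ltr_wpDl.
by lra.
Qed.

(** * Limits and cluster points *)

Lemma cvg_sumr (R : realType) (T : Type) (F : set_system T) {FF : Filter F}
    (I : Type) (r : seq I) (f : I -> T -> R) (a : I -> R) :
  (forall i, f i x @[x --> F] --> a i) ->
  \sum_(i <- r) f i x @[x --> F] --> \sum_(i <- r) a i.
Proof.
move=> fa; apply: cvg_big => //; exact: add_continuous.
Qed.

Lemma cvg_sumr0 (R : realType) (T : Type) (F : set_system T) {FF : Filter F}
    (I : Type) (r : seq I) (f : I -> T -> R) :
  (forall i, f i x @[x --> F] --> (0 : R)) ->
  \sum_(i <- r) f i x @[x --> F] --> (0 : R).
Proof.
move=> f0; rewrite -[X in _ --> X](big1_eq (op := +%R) r predT).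
exact: cvg_sumr.
Qed.

Lemma continuous_coord (R : realType) (T : Type) (t : T) :
  continuous (fun x : {ptws T -> R} => x t).
Proof. exact: (@proj_continuous {classic T} (fun=> R) t). Qed.

(** Every neighbourhood of [p] meets the set where the bound holds, so asymptotic inequalities pass
    to cluster points without extracting a subsequence. *)
Lemma cluster_le (R : realType) (T : topologicalType) (F : set_system T)
    {FF : Filter F} (p : T) (f : T -> R) (a : R) :
  cluster F p -> {for p, continuous f} ->
  (forall eps, 0 < eps -> \forall x \near F, f x <= a + eps) -> f p <= a.
Proof.
move=> Fp /cvgrPdist_le fp fa; apply/ler_addgt0Pl => eps eps0.
have e2 : 0 < eps / 2 by rewrite divr_gt0.
have [x [/= xa]] := Fp _ _ (fa _ e2) (fp _ e2).
by move=> /ler_normlW xp; lra.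
Qed.

Lemma near_infty_shiftS (P : nat -> Prop) :
  (\forall n \near \oo, P n.+1) -> \forall n \near \oo, P n.
Proof. by case=> N _ NP; exists N.+1 => // -[|n] //; exact: NP. Qed.

(** * The dual function of a box-constrained linear program *)

Section LinearProgram.
Variables (R : realType) (C V : finType) (p : V -> R) (q : C -> V -> R).
Implicit Types (l : C -> R) (x : V -> R).

Definition load x c : R := \sum_v q c v * x v.

Definition reduced_price l v : R := p v - \sum_c l c * q c v.

(** The maximum of the Lagrangian over the unit box, in closed form: a variable is 1 if its reduced
    price is positive and 0 otherwise. *)
Definition dual l : R := \sum_v Num.max 0 (reduced_price l v).

Definition unit_box x : Prop := forall v, 0 <= x v <= 1.

Lemma reduced_priceE l x :
  \sum_v reduced_price l v * x v = \sum_v p v * x v - \sum_c l c * load x c.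
Proof.
under eq_bigr do rewrite mulrBl.
rewrite sumrB; congr (_ - _); under eq_bigr do rewrite mulr_suml.
rewrite exchange_big; apply: eq_bigr => c _.
by rewrite mulr_sumr; apply: eq_bigr => v _; rewrite mulrA.
Qed.

Lemma le_dual l x : unit_box x -> \sum_v reduced_price l v * x v <= dual l.
Proof.
move=> x01; apply: ler_sum => v _; have /andP[x0 x1] := x01 v.
by rewrite le_max; case: (lerP (reduced_price l v) 0) => r0; apply/orP; nra.
Qed.

Lemma dual_attained l x : unit_box x ->
  (forall y, unit_box y ->
     \sum_v reduced_price l v * y v <= \sum_v reduced_price l v * x v) ->
  \sum_v reduced_price l v * x v = dual l.
Proof.
move=> x01 xmax; apply/eqP; rewrite eq_le le_dual//=.
have /xmax : unit_box (fun v => (0 < reduced_price l v)%R%:R).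
  by move=> v; case: ltP; rewrite ?lexx ?ler01.
apply: le_trans.
by apply: ler_sum => v _; case: ltP => _; rewrite ?mulr1 ?mulr0.
Qed.

(** Multipliers range over an unbounded space, so continuity alone does not give a minimum. Instead,
    the epigraph of [dual] is a polyhedron on which [s] is nonnegative. *)
Lemma dual_min : exists l, forall l', dual l <= dual l'.
Proof.
(* [dual l <= s] says that every partial sum of reduced prices, over any set [A]
   of variables, is at most [s]. *)
pose rs := [seq (fun c => - \sum_(v in A) q c v, - \sum_(v in A) p v, 1 : R)
           | A : {set V} <- enum {: {set V}}].
have rsP l s : all (satisfies (index_enum C) l s) rs <-> dual l <= s.
  have cut (A : {set V}) : \sum_c (- \sum_(v in A) q c v) * l c
      <= - \sum_(v in A) p v + 1 * s = (\sum_(v in A) reduced_price l v <= s).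
    have -> : \sum_(v in A) reduced_price l v =
        \sum_(v in A) p v + \sum_c (- \sum_(v in A) q c v) * l c.
      rewrite sumrB exchange_big -sumrN; congr (_ + _); apply: eq_bigr => c _.
      by rewrite mulNr -mulr_sumr mulrC.
    by apply/idP/idP => ?; lra.
  rewrite all_map.
  (* The variables of positive reduced price form the set whose partial sum equals [dual l]. *)
  split=> [/allP/(_ (finset (fun v => 0 < reduced_price l v)))|ds].
    rewrite mem_enum => /(_ isT); rewrite /= /satisfies /= cut.
    rewrite /dual big_mkcond; congr (_ <= _); apply: eq_bigr => v _.
    by rewrite inE; case: ltP.
  apply/allP => A _; rewrite /= /satisfies /= cut; apply: le_trans ds.
  rewrite big_mkcond; apply: ler_sum => v _.
  by case: ifP => _; rewrite le_max lexx ?orbT.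
have [||s [[l /rsP ls] smin]] := @fourier_motzkin_min R C _ rs 0
  (index_enum_uniq C).
- by exists (dual (fun=> 0)), (fun=> 0); apply/rsP.
- move=> s l /rsP; apply: le_trans.
  by apply: sumr_ge0 => v _; rewrite le_max lexx.
- by exists l => l'; apply: le_trans ls (smin _ l' _); apply/rsP.
Qed.

Lemma load_bound x c : unit_box x -> `|load x c| <= \sum_v `|q c v|.
Proof.
move=> x01; apply: le_trans (ler_norm_sum _ _ _) _; apply: ler_sum => v _.
have /andP[x0 x1] := x01 v.
by rewrite normrM (ger0_norm x0) ler_piMr.
Qed.

End LinearProgram.

(** * Convergence of the dual subgradient method *)

Section DualSubgradient.
Variables (R : realType) (C V : finType) (p : V -> R) (q : C -> V -> R).
Implicit Types (l m : C -> R) (lam : nat -> C -> R) (x : nat -> V -> R).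

(* Iterations are numbered from 0, so that the step of iteration [k] is
   [1 / (k + 1)]. *)
Definition dual_subgradient lam x : Prop := forall k,
  [/\ unit_box (x k),
      \sum_v reduced_price p q (lam k) v * x k v = dual p q (lam k) &
      forall c, lam k.+1 c = lam k c + k.+1%:R^-1 * load q (x k) c].

Definition sqdist l m : R := \sum_c (l c - m c) ^+ 2.

(** A uniform bound on the squared norm of the subgradients. *)
Definition load_sqbound : R := \sum_c (\sum_v `|q c v|) ^+ 2.

(** A Lyapunov function: its second term dominates the sum of all squared steps still to come. *)
Definition energy lam m k : R :=
  sqdist (lam k) m + 2 * load_sqbound * k.+1%:R^-1.

Lemma sqdist_ge0 l m : 0 <= sqdist l m.
Proof. by apply: sumr_ge0 => c _; exact: sqr_ge0. Qed.

Lemma load_sqbound_ge0 : 0 <= load_sqbound.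
Proof. by apply: sumr_ge0 => c _; exact: sqr_ge0. Qed.

Lemma sqr_le_sqdist l m c : (l c - m c) ^+ 2 <= sqdist l m.
Proof.
rewrite /sqdist (bigD1 c)//= lerDl; apply: sumr_ge0 => i _; exact: sqr_ge0.
Qed.

(** Expand the square. The cross term is controlled because minus the load of [x k] is a subgradient
    of [dual] at [lam k]: [x k] attains [dual] there and is admissible in the maximum at [m]. *)
Lemma fejer lam x m k : dual_subgradient lam x ->
  sqdist (lam k.+1) m <= sqdist (lam k) m
    + 2 * k.+1%:R^-1 * (dual p q m - dual p q (lam k))
    + load_sqbound * k.+1%:R^-1 ^+ 2.
Proof.
move=> /(_ k)[xk01 xkmax step]; set t := _^-1 in step *.
have t0 : 0 <= t by rewrite invr_ge0.
have -> : sqdist (lam k.+1) m = sqdist (lam k) m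
    + 2 * t * (\sum_c lam k c * load q (x k) c - \sum_c m c * load q (x k) c)
    + t ^+ 2 * \sum_c load q (x k) c ^+ 2.
  rewrite -sumrB !mulr_sumr -!big_split; apply: eq_bigr => c _ /=.
  by rewrite step; ring.
apply: lerD; [apply: lerD => //; apply: ler_wpM2l; first by rewrite mulr_ge0|].
  have := le_dual p q m xk01; have := xkmax.
  by rewrite !reduced_priceE; lra.
rewrite mulrC ler_wpM2r ?sqr_ge0//; apply: ler_sum => c _.
by rewrite -[leLHS]real_normK ?num_real// lerXn2r ?nnegrE ?load_bound ?sumr_ge0.
Qed.

(* The terms [2 B / k] of the energy absorb the squared steps [B / k ^ 2]. *)
Lemma energy_descent lam x m k : dual_subgradient lam x ->
  energy lam m k.+1 + 2 * k.+1%:R^-1 * (dual p q (lam k) - dual p q m)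
    <= energy lam m k.
Proof.
move=> /fejer-/(_ m k); rewrite /energy.
(* With [a = k + 1], the right side is [2 / (a (a + 1))], and [a + 1 <= 2 a]. *)
have : k.+1%:R^-1 ^+ 2 <= 2 * (k.+1%:R^-1 - k.+2%:R^-1) :> R.
  rewrite -[k.+2%:R]natr1; set a := k.+1%:R; have a1 : 1 <= a by rewrite ler1n.
  move: a a1 => a a1; rewrite -subr_ge0.
  have -> : 2 * (a^-1 - (a + 1)^-1) - a^-1 ^+ 2 = (a - 1) / (a ^+ 2 * (a + 1)).
    by field; apply/andP; split; rewrite gt_eqF//; lra.
  by apply: divr_ge0; [lra|apply: mulr_ge0; [exact: sqr_ge0|lra]].
by move=> /(ler_wpM2l load_sqbound_ge0); set a := _^-1; set b := _^-1; lra.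
Qed.

Lemma energy_nincr lam x m k n : dual_subgradient lam x ->
  (forall l, dual p q m <= dual p q l) -> (k <= n)%N ->
  energy lam m n <= energy lam m k.
Proof.
move=> meth mmin; elim: n => [|n IH]; first by rewrite leqn0 => /eqP ->.
rewrite leq_eqVlt ltnS => /predU1P[->//|/IH]; apply: le_trans.
apply: le_trans (energy_descent m n meth); rewrite lerDl.
by rewrite !mulr_ge0 ?subr_ge0.
Qed.

(** Otherwise every step from [N] on would consume at least [2 eps / (k + 1)] of a nonnegative
    energy, and the harmonic series would converge. *)
Lemma dual_values_frequently lam x m eps N : dual_subgradient lam x ->
  0 < eps -> exists2 k, (N <= k)%N & dual p q (lam k) < dual p q m + eps.
Proof.
move=> meth eps0; apply: contrapT => /forall2NP nearN.
have far k : (N <= k)%N -> dual p q m + eps <= dual p q (lam k).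
  by move=> Nk; have [//|/negP] := nearN k; rewrite -leNgt.
have bound n : \sum_(N <= k < N + n) (2 * eps) * k.+1%:R^-1
    <= energy lam m N - energy lam m (N + n)%N.
  elim: n => [|n IH]; first by rewrite addn0 big_geq// subrr.
  rewrite addnS big_nat_recr ?leq_addr//=.
  have t0 : 0 <= (N + n).+1%:R^-1 :> R by rewrite invr_ge0.
  have := ler_wpM2l t0 (far (N + n)%N (leq_addr _ _)).
  have := energy_descent m (N + n) meth.
  by set t := _^-1; lra.
apply: (@dvg_harmonic R); rewrite -(is_cvg_series_restrict N).
apply: nondecreasing_is_cvgn.
  apply/nondecreasing_seqP => n /=; case: (leqP N n) => Nn.
    by rewrite big_nat_recr//= lerDl invr_ge0.
  by rewrite !big_geq// ltnW.
exists (energy lam m N / (2 * eps)) => _ [n _ <-] /=.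
rewrite ler_pdivlMr ?mulr_gt0//= mulr_suml.
case: (leqP N n) => [/subnKC <-|Nn]; last first.
  rewrite big_geq ?(ltnW Nn)// /energy addr_ge0 ?sqdist_ge0//.
  by rewrite !mulr_ge0 ?load_sqbound_ge0 ?invr_ge0.
under eq_bigr do rewrite mulrC.
apply: le_trans (bound _) _; rewrite gerBl /energy addr_ge0 ?sqdist_ge0//.
by rewrite !mulr_ge0 ?load_sqbound_ge0 ?invr_ge0.
Qed.

End DualSubgradient.

(** * Limits of the multipliers and of the averaged iterates *)

Section DualSubgradientConvergence.
Variables (R : realType) (C V : finType) (p : V -> R) (q : C -> V -> R).
Implicit Types (l m : C -> R) (lam : nat -> C -> R) (x : nat -> V -> R).

Lemma continuous_reduced_price v :
  continuous ((fun l => reduced_price p q l v) : {ptws C -> R} -> R).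
Proof.
move=> l; apply: (@cvgB _ _ _ (nbhs l) _ (fun=> p v)
  (fun l' : {ptws C -> R} => \sum_c l' c * q c v)).
  exact: cvg_cst.
apply: (@cvg_sumr _ _ (nbhs l) _ _ _ (fun c l' => l' c * q c v)) => c.
by apply: cvgMr_tmp; exact: continuous_coord.
Qed.
Lemma continuous_dual : continuous (dual p q : {ptws C -> R} -> R).
Proof.
move=> l; rewrite /dual.
apply: (@cvg_sumr _ _ (nbhs l) _ _ _
  (fun v l' => Num.max 0 (reduced_price p q l' v))) => v.
refine (@continuous_max R {ptws C -> R} (cst 0)
  (fun l => reduced_price p q l v) l _ _).
exact: (@cst_continuous {ptws C -> R} R 0 l).
exact: continuous_reduced_price.
Qed.

Lemma continuous_sqdist m :
  continuous ((fun l => sqdist l m) : {ptws C -> R} -> R).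
Proof.
move=> l; rewrite /sqdist.
apply: (@cvg_sumr _ _ (nbhs l) _ _ _ (fun c l' => (l' c - m c) ^+ 2)) => c.
have cB : (fun l : {ptws C -> R} => l c - m c) l' @[l' --> l] --> l c - m c.
  apply: (@cvgB _ _ _ (nbhs l) _ (fun l' : {ptws C -> R} => l' c) (fun=> m c)).
    exact: continuous_coord.
  exact: (@cst_continuous {ptws C -> R} R (m c) l).
exact: cvgM.
Qed.

(** Along [s] the dual values tend to the minimum, and the energy keeps the multipliers in a compact
    box around [m]. Continuity of [dual] makes any cluster point of [lam \o s] optimal. *)
Lemma cluster_multipliers lam x : dual_subgradient p q lam x ->
  exists l, (forall l', dual p q l <= dual p q l') /\
    forall eps N, 0 < eps -> exists2 k, (N <= k)%N & sqdist (lam k) l < eps.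
Proof.
move=> meth; have [m mmin] := dual_min p q.
have /choice[s sP] (j : nat) : exists k,
    (j <= k)%N /\ dual p q (lam k) < dual p q m + j.+1%:R^-1.
  have [|k] := @dual_values_frequently _ _ _ p q lam x m j.+1%:R^-1 j meth.
    by rewrite invr_gt0.
  by exists k.
(* Adding 1 avoids a square root: [t ^ 2 <= E] implies [t <= E + 1]. *)
pose b := energy q lam m 0 + 1.
have lamb k c : `|lam k c - m c| <= b.
  have : (lam k c - m c) ^+ 2 <= energy q lam m 0.
    apply: le_trans (sqr_le_sqdist _ _ _) _.
    apply: le_trans (energy_nincr meth mmin (leq0n k)).
    by rewrite lerDl !mulr_ge0 ?load_sqbound_ge0 ?invr_ge0.
  rewrite -real_normK ?num_real// /b; set t := `|_|; nra.
have Kcompact : compact [set f : {ptws C -> R} |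
    forall c, `[m c - b, m c + b]%classic (f c)].
  exact: (@tychonoff C (fun=> R) (fun c => `[m c - b, m c + b]%classic)
    (fun c => @segment_compact R _ _)).
pose F := (lam \o s : nat -> {ptws C -> R}) @ \oo.
have [|l [_ lcl]] := Kcompact F (fmap_proper_filter _ _).
  exists 0%N => // j _ c; rewrite /= in_itv/= -ler_distlC distrC; exact: lamb.
exists l; split.
  move=> l'; apply: le_trans (mmin l').
  apply: (cluster_le lcl (@continuous_dual l)) => eps eps0.
  suff : \forall j \near \oo, dual p q (lam (s j)) <= dual p q m + eps by [].
  near=> j; apply: le_trans (ltW (sP j).2) _; rewrite lerD2l.
  near: j; have /cvgrPdist_le/(_ _ eps0) := @cvg_harmonic R.
  by apply: filterS => j; rewrite sub0r normrN ger0_norm// invr_ge0.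
move=> eps N eps0; apply: contrapT => /forall2NP far.
(* If late multipliers all stayed away from [l], then in the limit [l] would be away from itself.
   The signs are flipped because [cluster_le] transfers upper bounds. *)
suff : - sqdist l l <= - eps.
  rewrite lerN2 /sqdist big1 => [|c _]; first by rewrite leNgt eps0.
  by rewrite subrr expr0n.
apply: (@cluster_le _ _ _ _ l (fun l' => - sqdist l' l) _ lcl).
  exact: (@cvgN _ _ _ (nbhs l) _ (fun l' => sqdist l' l) _
    (@continuous_sqdist l l)).
move=> e e0.
suff : \forall j \near \oo, - sqdist (lam (s j)) l <= - eps + e by [].
near=> j.
have [|/negP] := far (s j).
  move/negP; rewrite -ltnNge => /(leq_ltn_trans (sP j).1).
  by rewrite ltnNge => /negP[]; near: j; exists N.
by rewrite -leNgt => ?; lra.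
Unshelve. all: by end_near. Qed.

(** Wait for an index where both [sqdist] to [l] and the tail term are below [eps ^ 2 / 2]; since
    the energy does not increase, the distance stays below [eps] from then on. *)
Lemma multipliers_cvg lam x : dual_subgradient p q lam x ->
  exists l, forall c, lam k c @[k --> \oo] --> l c.
Proof.
move=> meth; have [l [lmin lfreq]] := cluster_multipliers meth.
exists l => c; apply/cvgrPdist_lt => eps eps0.
have e2 : 0 < eps ^+ 2 / 2 by rewrite divr_gt0// exprn_gt0.
have tail : 2 * load_sqbound q * k.+1%:R^-1 @[k --> \oo] --> (0 : R).
  rewrite -(mulr0 (2 * load_sqbound q)); apply: cvgMl_tmp.
  exact: cvg_harmonic.
have /cvgrPdist_lt/(_ _ e2)[N _ NP] := tail.
have [k Nk kP] := lfreq _ N e2.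
exists k => // n /= kn.
rewrite distrC -(ltr_pXn2r (n := 2)) ?nnegrE ?(ltW eps0)//.
rewrite real_normK ?num_real//.
apply: le_lt_trans (sqr_le_sqdist _ _ _) _.
apply: (@le_lt_trans _ _ (energy q lam l n)).
  by rewrite lerDl !mulr_ge0 ?load_sqbound_ge0 ?invr_ge0.
apply: le_lt_trans (energy_nincr meth lmin kn) _.
have := NP _ Nk; rewrite sub0r normrN => /ltr_normlW h.
by rewrite [ltRHS]splitr; exact: ltrD kP h.
Qed.

(** Index [n] averages the [n.+1] iterates numbered from 0 to [n]. *)
Definition mean x (n : nat) : V -> R := fun v => arithmetic_mean (x ^~ v) n.

Lemma sum_mean (a : V -> R) x n :
  \sum_v a v * mean x n v = arithmetic_mean (fun k => \sum_v a v * x k v) n.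
Proof.
rewrite /mean /arithmetic_mean /= /series /= mulr_sumr.
under eq_bigr do rewrite mulrCA mulr_sumr.
by rewrite -mulr_sumr exchange_big mulr_sumr.
Qed.

Lemma mean_load_cvg lam x c : dual_subgradient p q lam x ->
  load q (mean x n) c @[n --> \oo] --> (0 : R).
Proof.
move=> meth; have [l lamP] := multipliers_cvg meth.
(* Summation by parts: the load of iteration [k] is [k.+1] times the increment of [lam]. *)
have abel n : \sum_(0 <= k < n) load q (x k) c
    = n%:R * lam n c - \sum_(0 <= k < n) lam k c.
  elim: n => [|n IH]; first by rewrite !big_geq// mul0r subrr.
  rewrite !big_nat_recr//= IH; have [_ _ ->] := meth n.
  rewrite mulrDr mulVKf ?pnatr_eq0// -[n.+1%:R]natr1; ring.
have -> : (fun n => load q (mean x n) c)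
    = (fun n => lam n.+1 c - arithmetic_mean (lam ^~ c) n).
  apply/funext => n; rewrite /load sum_mean /arithmetic_mean /= /series /=.
  by rewrite abel mulrBr mulKf ?pnatr_eq0.
rewrite -(subrr (l c)); apply: cvgB; last exact: cesaro.
by rewrite (cvg_shiftS (lam ^~ c)).
Qed.

Lemma le_arithmetic_mean (u w : nat -> R) n : (forall k, u k <= w k) ->
  arithmetic_mean u n <= arithmetic_mean w n.
Proof.
by move=> uw; rewrite /arithmetic_mean /= ler_wpM2l ?invr_ge0// ler_sum.
Qed.

Lemma arithmetic_mean_cst (a : R) n : arithmetic_mean (fun=> a) n = a.
Proof.
rewrite /arithmetic_mean /= /series /= sumr_const_nat subn0.
by rewrite -[a *+ _]mulr_natl mulKf ?pnatr_eq0.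
Qed.

(** Since [y] has zero load, optimality of [x k] at [lam k] bounds the value of [y] by that of [x k]
    minus [lam k] times the load of [x k]; average over [k]. *)
Lemma mean_value_ge lam x y eps : dual_subgradient p q lam x -> unit_box y ->
  (forall c, load q y c = 0) -> 0 < eps ->
  \forall n \near \oo,
    \sum_v p v * y v - eps <= \sum_v p v * mean x n v.
Proof.
move=> meth y01 y0 eps0; have [l lamP] := multipliers_cvg meth.
(* Splitting [lam k] as [l + (lam k - l)] leaves [w], a vanishing factor times a bounded load, and a
   multiple of the mean load. *)
pose w k := \sum_c (lam k c - l c) * load q (x k) c.
have w0 : w k @[k --> \oo] --> (0 : R).
  apply: cvg_sumr0 => c; apply: norm_cvg0.
  apply: (@squeeze_cvgr _ _ _ _ (fun=> 0)
    (fun k => `|lam k c - l c| * \sum_v `|q c v|)).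
  - apply: nearW => k; rewrite normr_ge0/= normrM ler_wpM2l// load_bound//.
    by have [] := meth k.
  - exact: cvg_cst.
  - rewrite -[X in _ --> X](mul0r (\sum_v `|q c v|)); apply: cvgMr_tmp.
    rewrite -(normr0 R) -(subrr (l c)); apply: cvg_norm.
    by apply: cvgB => //; exact: cvg_cst.
have r0 : arithmetic_mean w n + \sum_c l c * load q (mean x n) c
    @[n --> \oo] --> (0 : R).
  rewrite -[X in _ --> X](addr0 0); apply: cvgD; first exact: cesaro.
  apply: cvg_sumr0 => c; rewrite -[X in _ --> X](mulr0 (l c)); apply: cvgMl_tmp.
  exact: mean_load_cvg meth.
have := r0 => /cvgrPdist_le/(_ _ eps0); apply: filterS => n.
rewrite sub0r normrN => /ler_normlP[+ _].
suff : \sum_v p v * y v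
    + (arithmetic_mean w n + \sum_c l c * load q (mean x n) c)
    <= \sum_v p v * mean x n v by lra.
have -> : arithmetic_mean w n + \sum_c l c * load q (mean x n) c
    = arithmetic_mean (fun k => \sum_c lam k c * load q (x k) c) n.
  have -> : \sum_c l c * load q (mean x n) c =
      n.+1%:R^-1 * \sum_(0 <= k < n.+1) \sum_c l c * load q (x k) c.
    rewrite exchange_big mulr_sumr; apply: eq_bigr => c _.
    by rewrite /load sum_mean -mulr_sumr mulrCA.
  rewrite /arithmetic_mean /= /series /= -mulrDr -big_split; congr (_ * _).
  apply: eq_bigr => k _; rewrite -big_split; apply: eq_bigr => c _ /=.
  by rewrite -mulrDl subrK.
rewrite sum_mean -(arithmetic_mean_cst (\sum_v p v * y v) n).
rewrite /arithmetic_mean /= -mulrDr -/(arithmetic_mean _ _).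
rewrite /series /= -big_split; apply: (@le_arithmetic_mean
  (fun k => \sum_v p v * y v + \sum_c lam k c * load q (x k) c)) => k.
have [x01 xE _] := meth k; have := le_dual p q (lam k) y01.
rewrite -xE !reduced_priceE.
have -> : \sum_c lam k c * load q y c = 0.
  by rewrite big1 => // c _; rewrite y0 mulr0.
lra.
Qed.

End DualSubgradientConvergence.

(** * The market clearing problem *)

Section MarketClearing.
Variables (R : realType) (M : market R).
Implicit Types (x : acceptance M) (lam : carrier -> R).

(** A finite type of indices for the variables, as the linear program above requires. *)
Definition column : finType :=
  (Defs.order M gas + Defs.order M elec + Defs.order M heat
   + conv_order M gas_to_elec + conv_order M gas_to_heat)%type.

Definition var_of (j : column) : var M :=
  match j with
  | inl (inl (inl (inl o))) => Elem o
  | inl (inl (inl (inr o))) => Elem o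
  | inl (inl (inr o)) => Elem o
  | inl (inr co) => Conv co
  | inr co => Conv co
  end.

Definition column_of (v : var M) : column :=
  match v with
  | Elem c o =>
    match c return Defs.order M c -> column with
    | gas => fun o => inl (inl (inl (inl o)))
    | elec => fun o => inl (inl (inl (inr o)))
    | heat => fun o => inl (inl (inr o))
    end o
  | Conv t co =>
    match t return conv_order M t -> column with
    | gas_to_elec => fun co => inl (inr co)
    | gas_to_heat => fun co => inr co
    end co
  end.

Lemma var_ofK : cancel var_of column_of.
Proof. by case=> [[[[]|]|]|]. Qed.

(** The three indices stand for the carriers; the default branch is reached only by 2. *)
Definition carrier_of (i : 'I_3) : carrier :=
  match val i with 0%N => gas | 1%N => elec | _ => heat end.

Definition welfare_coef (j : column) : R :=
  match var_of j with
  | Elem _ o => price M o * qty M o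
  | Conv _ co => - (conv_price M co * conv_qty M co)
  end.

Definition balance_coef (c : carrier) (j : column) : R :=
  match var_of j with
  | Elem c' o =>
    match c, c' with
    | gas, gas | elec, elec | heat, heat => qty M o
    | _, _ => 0
    end
  | Conv t co =>
    match c, t with
    | gas, _ => conv_qty M co
    | elec, gas_to_elec | heat, gas_to_heat =>
      - (efficiency M co * conv_qty M co)
    | _, _ => 0
    end
  end.

Lemma welfareE x : welfare x = \sum_j welfare_coef j * x (var_of j).
Proof.
rewrite /welfare !big_sumType /= -!sumrN; congr (_ + _ + _);
  by apply: eq_bigr => co _; rewrite -mulNr.
Qed.

Lemma balanceE x c : balance x c = \sum_j balance_coef c j * x (var_of j).
Proof.
have sum0 (I : finType) (f : I -> R) : \sum_i 0 * f i = 0.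
  by rewrite big1 => // i _; rewrite mul0r.
rewrite /balance !big_sumType.
case: c => /=; rewrite !sum0 ?addr0 ?add0r ?addrA// -sumrN; congr (_ + _);
  by apply: eq_bigr => co _; rewrite -mulNr.
Qed.

Let q (i : 'I_3) := balance_coef (carrier_of i).

Lemma lagrangianE lam x : lagrangian lam x =
  \sum_j reduced_price welfare_coef q (lam \o carrier_of) j * x (var_of j).
Proof.
rewrite reduced_priceE -welfareE /lagrangian !big_ord_recl big_ord0 /load.
by rewrite -!balanceE /carrier_of /=; ring.
Qed.

Lemma process_unit (lam : nat -> carrier -> R) (x : nat -> acceptance M) k v :
  subgradient_process lam x -> (0 < k)%N -> 0 <= x k v <= 1.
Proof.
move=> process /process[carr [conv _] _].
by case: v => [c o|t co]; [have [/(_ o)] := carr c|exact: conv].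
Qed.

(** The four subproblems share no variable, so by [lagrangian_split] their solutions jointly
    maximise the Lagrangian. Indices shift by one since the process starts at 1. *)
Lemma process_dual_subgradient (lam : nat -> carrier -> R)
    (x : nat -> acceptance M) : subgradient_process lam x ->
  dual_subgradient welfare_coef q (fun k i => lam k.+1 (carrier_of i))
    (fun k j => x k.+1 (var_of j)).
Proof.
move=> process k; have [carr conv step] := process k.+1 isT.
have x01 : unit_box (fun j => x k.+1 (var_of j)).
  by move=> j; exact: process_unit process _.
split=> // [|i]; last by rewrite step balanceE.
apply: dual_attained => // z z01.
(* Composing with [column_of] makes [z] an acceptance vector, to which the subproblems apply. *)
have zE j : z j = (z \o column_of) (var_of j) by rewrite /= var_ofK.
rewrite (eq_bigr (fun j =>
  reduced_price welfare_coef q (lam k.+1 \o carrier_of) j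
  * (z \o column_of) (var_of j))) => [|j _]; last by rewrite -zE.
rewrite -lagrangianE -(lagrangianE (lam k.+1)) !lagrangian_split.
have zcol01 v : 0 <= (z \o column_of) v <= 1 by exact: z01.
apply: lerD; last exact: conv.2 (fun t co => zcol01 _).
apply: lerD; last exact: (carr heat).2 (fun o => zcol01 _).
apply: lerD; last exact: (carr elec).2 (fun o => zcol01 _).
exact: (carr gas).2 (fun o => zcol01 _).
Qed.

Lemma continuous_welfare : continuous (@welfare R M).
Proof.
move=> x.
rewrite (_ : @welfare R M = fun x => \sum_j welfare_coef j * x (var_of j)).
  apply: (@cvg_sumr _ _ (nbhs x) _ _ _
    (fun j x => welfare_coef j * x (var_of j))) => j.
  by apply: cvgMl_tmp; exact: continuous_coord.
by apply/funext => y; exact: welfareE.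
Qed.

Lemma continuous_balance c : continuous ((@balance R M)^~ c).
Proof.
move=> x.
rewrite (_ : (@balance R M)^~ c =
  fun x => \sum_j balance_coef c j * x (var_of j)).
  apply: (@cvg_sumr _ _ (nbhs x) _ _ _
    (fun j x => balance_coef c j * x (var_of j))) => j.
  by apply: cvgMl_tmp; exact: continuous_coord.
by apply/funext => y; exact: balanceE.
Qed.

Lemma averageS (x : nat -> acceptance M) n v :
  average x n.+1 v = arithmetic_mean (fun k => x k.+1 v) n.
Proof. by rewrite /average big_add1. Qed.

End MarketClearing.

Theorem proposition8 (R : realType) (M : market R)
    (lam : nat -> carrier -> R) (x : nat -> acceptance M)
    (process : subgradient_process lam x) (xbar : acceptance M)
    (accumulation : cluster (average x @ \oo) xbar) :
  optimal_clearing xbar.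
Proof.
have meth := process_dual_subgradient process.
(* Bounds are asked at [n.+1] because [averageS] relates that average to the mean of index [n]. *)
have xbar_le (f : acceptance M -> R) a : {for xbar, continuous f} ->
    (forall eps, 0 < eps ->
       \forall n \near \oo, f (average x n.+1) <= a + eps) -> f xbar <= a.
  move=> fc fa; apply: (cluster_le accumulation fc) => eps /fa fe.
  exact: (@near_infty_shiftS (fun n => f (average x n) <= a + eps)).
have balance0 c : balance (average x n.+1) c @[n --> \oo] --> (0 : R).
  have [i ->] : exists i, c = carrier_of i.
    by case: c; [exists ord0|exists (lift ord0 ord0)|exists ord_max].
  under eq_fun do rewrite balanceE.
  under eq_fun do under eq_bigr do rewrite averageS.
  exact: (mean_load_cvg i meth).
have opp_continuous (f : acceptance M -> R) : {for xbar, continuous f} ->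
    {for xbar, continuous (fun x => - f x)}.
  exact: (@cvgN _ _ _ (nbhs xbar)).
have welfare_mean n : welfare (average x n.+1) =
    \sum_j welfare_coef j * mean (fun k j => x k.+1 (var_of j)) n j.
  by rewrite welfareE; apply: eq_bigr => j _; rewrite averageS.
split; last first.
  (* Negation turns the lower bound on welfare into the upper bound that [xbar_le] handles. *)
  move=> y [y0 y01]; rewrite -[leLHS]opprK lerNl.
  apply: (xbar_le (fun x => - welfare x)) => [|eps eps0].
    by apply: opp_continuous; exact: continuous_welfare.
  have box_y : unit_box (fun j => y (var_of j)) by move=> j; exact: y01.
  have load_y i :
      load (fun i => balance_coef (carrier_of i)) (fun j => y (var_of j)) i = 0.
    by rewrite /load -balanceE.
  have := mean_value_ge meth box_y load_y eps0; apply: filterS => n.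
  by rewrite -welfare_mean -welfareE; lra.
split=> [c|v].
  apply/eqP; rewrite eq_le -[X in _ && X]oppr_le0; apply/andP; split.
    apply: (xbar_le (fun x => balance x c)) => [|eps eps0].
      exact: continuous_balance.
    have /cvgrPdist_le/(_ _ eps0) := balance0 c; apply: filterS => n.
    by rewrite sub0r normrN add0r => /ler_normlW.
  apply: (xbar_le (fun x => - balance x c)) => [|eps eps0].
    by apply: opp_continuous; exact: continuous_balance.
  have /cvgrPdist_le/(_ _ eps0) := balance0 c; apply: filterS => n.
  by rewrite sub0r add0r => /ler_normlW.
(* The constants 0 and 1 are rewritten as their own means, so the bounds hold termwise. *)
have mean01 n : 0 <= average x n.+1 v <= 1.
  rewrite averageS -[X in X <= _ <= _](arithmetic_mean_cst (0 : R) n).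
  rewrite -[X in _ <= _ <= X](arithmetic_mean_cst (1 : R) n).
  by rewrite !le_arithmetic_mean// => k;
    have /andP[] := process_unit v process (ltn0Sn k).
rewrite -oppr_le0; apply/andP; split.
  apply: (xbar_le (fun x => - x v)) => [|eps eps0].
    by apply: opp_continuous; exact: continuous_coord.
  by apply: nearW => n; have /andP[] := mean01 n; lra.
apply: (xbar_le (fun x => x v)) => [|eps eps0]; first exact: continuous_coord.
by apply: nearW => n; have /andP[] := mean01 n; lra.
Qed.
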